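(* Let $0 \le \mu_i < L_i < \infty$ for all $i\in [m]$. Given $m$ points $x_i^\star \in \mathbb{R}^n$, $i\in [m]$, a point $x^\star \in \mathbb{R}^n$ is a minimizer of the sum $\sum_{i=1}^m f_i(x)$ for some functions $f_i\in\mathcal{M}_{\mu_i,L_i}(x_i^\star)$, $i\in [m]$, if and only if $$\Big\| \sum_{i\in [m]} (L_i+\mu_i)(x^\star-x_i^\star) \Big\|\leq \sum_{i\in [m]} (L_i-\mu_i)\| x^\star-x_i^\star \|.$$
   Context: $[m]=\{1,\dots,m\}$. $\|\cdot\|$ and $\langle\cdot,\cdot\rangle$ are the Euclidean norm and dot product on $\mathbb{R}^n$. For a convex $f:\mathbb{R}^n\to(-\infty,\infty]$ and $x\in\mathrm{dom}\, f$, $\partial f(x)=\{g: f(y)\ge f(x)+\langle g,y-x\rangle\ \forall y\in\mathbb{R}^n\}$. A convex function $f$ is $L$-smooth ($L\in(0,\infty]$) if $\|g_1-g_2\|\le L\|x_1-x_2\|$ for all $x_1,x_2\in\mathbb{R}^n$, $g_1\in\partial f(x_1)$, $g_2\in\partial f(x_2)$; if $L<\infty$ this means $f$ is differentiable on $\mathbb{R}^n$ with $L$-Lipschitz gradient, and every convex function is regarded as $\infty$-smooth. $f$ is $\mu$-strongly convex ($\mu\ge 0$) if $x\mapsto f(x)-\frac{\mu}{2}\|x\|^2$ is convex. $\mathcal{F}_{\mu,L}(\mathbb{R}^n)$ is the set of closed proper convex functions $\mathbb{R}^n\to(-\infty,\infty]$ that are $L$-smooth and $\mu$-strongly convex, and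 $\mathcal{M}_{\mu,L}(z)$ is the set of functions in $\mathcal{F}_{\mu,L}(\mathbb{R}^n)$ for which $z$ is a (global) minimizer. *)

(* Defs.v *)
(* R^n is 'rV[R]_n for R : realType. *)
From HB Require Import structures.
From mathcomp Require Import all_boot all_order all_algebra.
From mathcomp Require Import all_classical all_reals all_analysis.

Set Implicit Arguments.
Unset Strict Implicit.
Unset Printing Implicit Defensive.
Import Order.TTheory GRing.Theory Num.Theory.
Import numFieldNormedType.Exports.
Local Open Scope classical_set_scope.
Local Open Scope ring_scope.

Definition dotp (R : realType) (n : nat) (x y : 'rV[R]_n) : R :=
  \sum_(i < n) x 0 i * y 0 i.

(* The library's norm `|x| on 'rV[R]_n is the sup norm; this is the Euclidean
   one. *)
Definition enorm (R : realType) (n : nat) (x : 'rV[R]_n) : R :=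
  Num.sqrt (dotp x x).

Definition dom (R : realType) (n : nat) (f : 'rV[R]_n -> \bar R) :
    set 'rV[R]_n :=
  [set x | (f x < +oo)%E].

Definition epigraph (R : realType) (n : nat) (f : 'rV[R]_n -> \bar R) :
    set ('rV[R]_n * R) :=
  [set p | (f p.1 <= p.2%:E)%E].

(* Functions R^n -> (-oo, +oo] are encoded as functions into \bar R; the bound
   -oo < f x is imposed here. *)
Definition proper_fun (R : realType) (n : nat) (f : 'rV[R]_n -> \bar R) : Prop :=
  (forall x, (-oo < f x)%E) /\ dom f !=set0.

(* The topology of 'rV[R]_n is the product topology, i.e. the Euclidean one. *)
Definition closed_fun (R : realType) (n : nat) (f : 'rV[R]_n -> \bar R) : Prop :=
  closed (epigraph f).

(* The library's convex_function is only for real-valued functions. With t in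
   the open interval, no product 0 * +oo occurs. *)
Definition convex_fun (R : realType) (n : nat) (f : 'rV[R]_n -> \bar R) : Prop :=
  forall (x y : 'rV[R]_n) (t : R), 0 < t < 1 ->
    (f (t *: x + (1 - t) *: y)%R <= t%:E * f x + (1 - t)%R%:E * f y)%E.

Definition subdiff (R : realType) (n : nat) (f : 'rV[R]_n -> \bar R)
    (x : 'rV[R]_n) : set 'rV[R]_n :=
  [set g | dom f x /\ forall y, (f x + (dotp g (y - x)%R)%:E <= f y)%E].

(* For L = +oo there is no constraint. This case is separated because
   +oo * 0 = 0 in \bar R, so the inequality would otherwise force
   subdifferentials to contain at most one point. *)
Definition smooth_fun (R : realType) (n : nat) (L : \bar R)
    (f : 'rV[R]_n -> \bar R) : Prop :=
  L = +oo%E \/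
  forall x1 x2 g1 g2 : 'rV[R]_n, subdiff f x1 g1 -> subdiff f x2 g2 ->
    ((enorm (g1 - g2)%R)%:E <= L * (enorm (x1 - x2)%R)%:E)%E.

Definition strongly_convex (R : realType) (n : nat) (mu : R)
    (f : 'rV[R]_n -> \bar R) : Prop :=
  convex_fun (fun x => (f x - (mu / 2 * enorm x ^+ 2)%R%:E)%E).

(* Intended for 0 <= mu and 0 < L <= +oo. *)
Definition classF (R : realType) (n : nat) (mu : R) (L : \bar R) :
    set ('rV[R]_n -> \bar R) :=
  [set f | [/\ proper_fun f, closed_fun f, convex_fun f,
               smooth_fun L f & strongly_convex mu f]].

Definition minimizer (R : realType) (n : nat) (f : 'rV[R]_n -> \bar R)
    (z : 'rV[R]_n) : Prop :=
  forall y, (f z <= f y)%E.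

Definition classM (R : realType) (n : nat) (mu : R) (L : \bar R)
    (z : 'rV[R]_n) : set ('rV[R]_n -> \bar R) :=
  [set f | classF mu L f /\ minimizer f z].

(* Main.v *)
Require Import Defs.
From HB Require Import structures.
From mathcomp Require Import all_boot all_order all_algebra.
From mathcomp Require Import all_classical all_reals all_analysis.
From mathcomp Require Import ring lra.

Import Order.TTheory GRing.Theory Num.Theory.
Import numFieldNormedType.Exports.
Local Open Scope classical_set_scope.
Local Open Scope ring_scope.

(** Both directions come from one description: for fixed x0 and x, the vectors g
that occur as the gradient at x of a function in M_(mu, L)(x0) are exactly those of
the ball with centre (L + mu) / 2 * (x - x0) and radius (L - mu) / 2 * |x - x0|.
By convexity, x minimizes a sum of such functions iff their gradients at x sum to
zero, so the question is whether zero is a sum of one vector from each ball. A sum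
of balls is the ball with the summed centre and the summed radius, and zero lies in
it iff the norm of the summed centre is at most the summed radius; this is the
inequality of the theorem, up to the factor 2.

The gradient lies in the ball ([gradient_in_ball]) by co-coercivity of the gradient
of f - mu / 2 * |.|^2, which follows by comparing the strongly convex lower bound at
one point with the quadratic upper bound ([descent]) at another.

Every vector g of the ball is attained ([classM_interpolation]) by a quadratic: with
d = x - x0 and v = g - mu d, take
y |-> mu / 2 * |y - x0|^2 + <v, y - x0>^2 / (2 <v, d>).
Membership of g in the ball says exactly that |v|^2 <= (L - mu) <v, d>, which bounds
the largest eigenvalue mu + |v|^2 / <v, d> of the Hessian by L.

A member of M_(mu, L) is only given as an extended-valued function whose subgradients
satisfy a Lipschitz condition, so it remains to see that it is finite and has a
subgradient at every point z ([subdiff_nonempty]). The proximal points of z have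
subgradients by construction; the Lipschitz condition bounds these subgradients, so
the proximal points tend to z as the step tends to zero, and a compactness argument
yields a subgradient at z. *)

(** * Euclidean geometry *)

Section Euclidean.
Context {R : realType} {n : nat}.
Implicit Types (x y z : 'rV[R]_n) (a : R).

Lemma dotpC x y : dotp x y = dotp y x.
Proof. by apply: eq_bigr => i _; rewrite mulrC. Qed.

Lemma dotpDl x y z : dotp (x + y) z = dotp x z + dotp y z.
Proof. by rewrite -big_split; apply: eq_bigr => i _; rewrite mxE mulrDl. Qed.

Lemma dotpZl a x y : dotp (a *: x) y = a * dotp x y.
Proof. by rewrite mulr_sumr; apply: eq_bigr => i _; rewrite mxE mulrA. Qed.

Lemma dotpNl x y : dotp (- x) y = - dotp x y.
Proof. by rewrite -scaleN1r dotpZl mulN1r. Qed.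

Lemma dotpDr x y z : dotp x (y + z) = dotp x y + dotp x z.
Proof. by rewrite dotpC dotpDl !(dotpC x). Qed.

Lemma dotpZr a x y : dotp x (a *: y) = a * dotp x y.
Proof. by rewrite dotpC dotpZl dotpC. Qed.

Lemma dotpNr x y : dotp x (- y) = - dotp x y.
Proof. by rewrite dotpC dotpNl dotpC. Qed.

Definition dotpE := (dotpDl, dotpDr, dotpNl, dotpNr, dotpZl, dotpZr).

Lemma dot0p x : dotp 0 x = 0.
Proof. by rewrite -(scale0r x) dotpZl mul0r. Qed.

Lemma dotp_suml (m : nat) (F : 'I_m -> 'rV[R]_n) y :
  dotp (\sum_i F i) y = \sum_i dotp (F i) y.
Proof.
by elim/big_ind2: _ => [|? ? ? ? <- <-|//]; rewrite ?dot0p ?dotpDl.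
Qed.

Lemma dotp_ge0 x : 0 <= dotp x x.
Proof. by apply: sumr_ge0 => i _; rewrite -expr2 sqr_ge0. Qed.

Lemma coord_sqr_le x i : x 0 i ^+ 2 <= dotp x x.
Proof.
rewrite /dotp (bigD1 i) //= -expr2 lerDl.
by apply: sumr_ge0 => j _; rewrite -expr2 sqr_ge0.
Qed.

Lemma dotp_le0 x : dotp x x <= 0 -> x = 0.
Proof.
move=> x0; apply/rowP => i; rewrite mxE; apply/eqP.
by rewrite -sqrf_eq0 eq_le sqr_ge0 (le_trans (coord_sqr_le x i)).
Qed.

Lemma enorm_ge0 x : 0 <= enorm x.
Proof. exact: sqrtr_ge0. Qed.

Lemma enorm_sqr x : enorm x ^+ 2 = dotp x x.
Proof. by rewrite sqr_sqrtr ?dotp_ge0. Qed.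

Lemma enorm_le x a : 0 <= a -> (enorm x <= a) = (dotp x x <= a ^+ 2).
Proof.
by move=> a0; rewrite -enorm_sqr ler_pXn2r // ?nnegrE ?enorm_ge0.
Qed.

Lemma enorm0 : enorm (0 : 'rV[R]_n) = 0.
Proof. by rewrite /enorm dot0p sqrtr0. Qed.

Lemma enormZ a x : enorm (a *: x) = `|a| * enorm x.
Proof.
by rewrite /enorm !dotpE mulrA -expr2 sqrtrM ?sqr_ge0 // sqrtr_sqr.
Qed.

Lemma dotp_CS x y : dotp x y <= enorm x * enorm y.
Proof.
have [->|y0] := eqVneq y 0.
  by rewrite dotpC dot0p mulr_ge0 ?enorm_ge0.
have yy : 0 < dotp y y.
  by rewrite lt_neqAle dotp_ge0 andbT eq_sym; apply: contra y0 => /eqP yy;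
     apply/eqP/dotp_le0; rewrite yy.
apply: le_trans (ler_norm _) _.
rewrite -(@ler_pXn2r _ 2) ?nnegrE ?normr_ge0 ?mulr_ge0 ?enorm_ge0 //.
rewrite exprMn !enorm_sqr -normrX ger0_norm ?sqr_ge0 //.
have := dotp_ge0 (dotp y y *: x - dotp x y *: y).
rewrite !dotpE (dotpC y x) => h.
rewrite -(ler_pM2l yy); lra.
Qed.

Lemma ler_enormD x y : enorm (x + y) <= enorm x + enorm y.
Proof.
rewrite enorm_le ?addr_ge0 ?enorm_ge0 // sqrrD !enorm_sqr !dotpE (dotpC y x).
by have := dotp_CS x y; rewrite mulr2n; lra.
Qed.

Lemma ler_enorm_sum (m : nat) (F : 'I_m -> 'rV[R]_n) :
  enorm (\sum_i F i) <= \sum_i enorm (F i).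
Proof.
elim/big_ind2: _ => [|x a y b xa yb|//]; first by rewrite enorm0.
exact: le_trans (ler_enormD _ _) (lerD xa yb).
Qed.

End Euclidean.

(** * Limits of one-parameter inequalities *)

Lemma ler_addinv (R : realType) (a b c : R) :
  (forall k : nat, a <= b + c / k.+2%:R) -> a <= b.
Proof.
move=> h; rewrite leNgt; apply/negP => ba.
have ab0 : 0 < a - b by rewrite subr_gt0.
pose k := Num.trunc (`|c| / (a - b)).
have hk : `|c| / (a - b) < k.+2%:R.
  apply: lt_trans (_ : k.+1%:R < _); last by rewrite ltr_nat.
  by apply: truncnS_gt.
move: hk (h k); rewrite ltr_pdivrMr // => hk.
have k0 : 0 < k.+2%:R :> R by rewrite ltr0n.
rewrite -lerBlDl ler_pdivlMr //; have := ler_norm c; lra.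
Qed.

(** Used with t the step of a perturbation of a point, to extract the first-order
part of an inequality after division by t. *)
Lemma ler_addscale (R : realType) (a b c : R) :
  (forall t, 0 < t < 1 -> a <= b + t * c) -> a <= b.
Proof.
move=> h; apply: (@ler_addinv _ _ _ c) => k; rewrite mulrC; apply: h.
by rewrite invr_gt0 ltr0n invf_lt1 ?ltr0n // ltr1n.
Qed.

(** * Compactness *)

Section Compactness.
Context {R : realType} {n : nat}.

Lemma dotp_continuous (T : topologicalType) (u v : T -> 'rV[R]_n) :
  continuous u -> continuous v -> continuous (fun t => dotp (u t) (v t)).
Proof.
move=> cu cv; rewrite /dotp; apply: continuous_big => [|i _].
  by move=> t; apply: cvgD; [exact: cvg_fst|exact: cvg_snd].
have cc (w : T -> 'rV[R]_n) : continuous w -> continuous (fun t => w t 0 i).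
  move=> cw t.
  exact: (@continuous_comp _ _ _ w (fun M : 'rV[R]_n => M 0 i) t (cw t)
    (@coord_continuous _ _ _ _ _ _)).
by move=> t; apply: cvgM; apply: cc.
Qed.

Lemma rV_continuousB (T : topologicalType) (u v : T -> 'rV[R]_n) :
  continuous u -> continuous v -> continuous (fun t => u t - v t).
Proof. by move=> cu cv t; apply: cvgB; [exact: cu | exact: cv]. Qed.

Lemma continuous_fun_le_closed (T : topologicalType) (u v : T -> R) :
  continuous u -> continuous v -> closed [set t | u t <= v t].
Proof.
move=> cu cv.
have -> : [set t | u t <= v t] = (fun t => u t - v t) @^-1` [set r | r <= 0].
  by apply/seteqP; split => t /=; rewrite subr_le0.
apply: preimage_closed; last exact: closed_le.
by move=> t _; apply: cvgB; [exact: cu|exact: cv].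
Qed.

Lemma euclidean_ball_compact (z : 'rV[R]_n) (D : R) :
  compact [set x : 'rV[R]_n | dotp (x - z) (x - z) <= D].
Proof.
apply: (@subclosed_compact _ _
   [set x : 'rV[R]_n | forall i, `[z 0 i - (D + 1), z 0 i + (D + 1)]%classic
      (x ord0 i)]).
- apply: continuous_fun_le_closed; last exact: cst_continuous.
  by apply: dotp_continuous; apply: rV_continuousB;
    solve [exact: cst_continuous | by move=> t].
- by apply: (@rV_compact R n
     (fun i => `[z 0 i - (D + 1), z 0 i + (D + 1)]%classic)) => i;
     exact: segment_compact.
- move=> x /= xD i; have := le_trans (coord_sqr_le (x - z) i) xD.
  rewrite !mxE in_itv /=; set u := x 0 i; set w := z 0 i => h.
  have := sqr_ge0 (u - w - 1); have := sqr_ge0 (u - w + 1).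
  by rewrite !expr2 in h * => h1 h2; apply/andP; split; lra.
Qed.

End Compactness.

(** * Subgradients exist everywhere *)

Section Subgradients.
Context {R : realType} {n : nat}.
Implicit Types (f : 'rV[R]_n -> \bar R) (x y z p g : 'rV[R]_n).

(** The proximal objective may be infinite and is only lower semicontinuous in y. On
the epigraph it becomes the continuous function (y, s) |-> s + k |y - z|^2, so the
extreme value theorem applies, on the compact part of the epigraph where the
objective can compete with its value at (x0, m0). The lower bound m0 of f confines
s there. *)
Lemma prox_exists f (x0 z : 'rV[R]_n) (m0 k : R) :
  closed_fun f -> f x0 = m0%:E -> minimizer f x0 -> 0 < k ->
  exists p r, [/\ f p = r%:E, m0 <= r,
    r + k * dotp (p - z) (p - z) <= m0 + k * dotp (x0 - z) (x0 - z) &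
    forall y s, (f y <= s%:E)%E ->
      r + k * dotp (p - z) (p - z) <= s + k * dotp (y - z) (y - z)].
Proof.
move=> fcl fx0 fmin k0; set D := dotp (x0 - z) (x0 - z).
have lb y s : (f y <= s%:E)%E -> m0 <= s.
  by move=> fy; rewrite -lee_fin -fx0; exact: le_trans (fmin y) fy.
pose B := [set x : 'rV[R]_n | dotp (x - z) (x - z) <= D]
  `*` `[m0, m0 + k * D]%classic.
pose K := epigraph f `&` B.
have D0 : 0 <= D by exact: dotp_ge0.
have kD : 0 <= k * D by rewrite mulr_ge0 // ltW.
have cB : compact B.
  by apply: compact_setX; [exact: euclidean_ball_compact|exact: segment_compact].
have cK : compact K.
  apply: (@subclosed_compact _ _ B) => //; last by move=> q [].
  apply: closedI => //; apply: compact_closed => //; exact: norm_hausdorff.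
have K0 : K !=set0.
  exists (x0, m0); split; first by rewrite /epigraph /= fx0.
  by split; rewrite /= // in_itv /= lexx lerDl.
pose phi (q : 'rV[R]_n * R) := q.2 + k * dotp (q.1 - z) (q.1 - z).
have cphi : continuous phi.
  move=> q; apply: cvgD; first exact: cvg_snd.
  apply: cvgM; first exact: cvg_cst.
  have cw : continuous (fun q : 'rV[R]_n * R => q.1 - z).
    by apply: rV_continuousB => ?; [exact: cvg_fst|exact: cvg_cst].
  exact: (dotp_continuous _ _ _ cw cw q).
have [[p r] /set_mem [epr [/= pD rD]] qmin] :=
  compact_EVT_min K0 cK (continuous_subspaceT cphi).
move: rD; rewrite in_itv /= => /andP[m0r rD].
have {}qmin q : K q -> phi (p, r) <= phi q by move=> /mem_set /qmin.
(* Otherwise (p, f p) would be in K with a smaller objective. *)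
have fpr : f p = r%:E.
  move: (epr) (fmin p); rewrite /epigraph /= fx0.
  case efp : (f p) => [s| |] //; rewrite !lee_fin => sr m0s.
  congr _%:E; apply/eqP; rewrite eq_le sr /=.
  have : K (p, s).
    split; first by rewrite /epigraph /= efp.
    by split => //=; rewrite in_itv /= m0s (le_trans sr).
  by move=> /qmin; rewrite /phi /= lerD2r.
have vp : r + k * dotp (p - z) (p - z) <= m0 + k * D.
  have := qmin (x0, m0); apply; split; first by rewrite /epigraph /= fx0.
  by split; rewrite /= // in_itv /= lexx lerDl.
exists p, r; split => // y s fys.
have m0s := lb _ _ fys.
have yz0 := dotp_ge0 (y - z).
have [yD|yD] := leP (dotp (y - z) (y - z)) D; last first.
  apply: le_trans vp _; apply: lerD => //; rewrite ler_pM2l //; exact: ltW.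
have [sD|sD] := leP s (m0 + k * D); last first.
  apply: le_trans vp _; apply: le_trans (ltW sD) _.
  by rewrite lerDl mulr_ge0 // ltW.
apply: (qmin (y, s)); split => //; split => //=.
by rewrite in_itv /= m0s.
Qed.

(** Optimality condition of the proximal problem: compare p with the point at
parameter t on the segment from p to y, divide by t and let t tend to zero. *)
Lemma subdiff_prox f z p (r k : R) :
  (forall x, (-oo < f x)%E) -> convex_fun f -> f p = r%:E ->
  (forall y s, (f y <= s%:E)%E ->
      r + k * dotp (p - z) (p - z) <= s + k * dotp (y - z) (y - z)) ->
  subdiff f p ((2 * k) *: (z - p)).
Proof.
move=> fpr fcv fp pmin; split; first by rewrite /dom /= fp ltry.
move=> y; move: (fpr y) (fcv y p); case fy : (f y) => [s| |] // _ cv.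
  rewrite fp lee_fin.
  apply: (@ler_addscale _ _ _ (k * dotp (y - p) (y - p))) => t t01.
  move: (cv t t01); rewrite fp -!EFinM -EFinD => /pmin.
  have -> : t *: y + (1 - t) *: p - z = (p - z) + t *: (y - p).
    by apply/rowP => i; rewrite !mxE; ring.
  rewrite -(opprB p z); move: (p - z) (y - p) => u w.
  rewrite !dotpE (dotpC w u) => h; case/andP: t01 => t0 _.
  rewrite -(ler_pM2l t0); lra.
by rewrite leey.
Qed.

Lemma subdiff_minimizer f x0 : dom f x0 -> minimizer f x0 -> subdiff f x0 0.
Proof. by move=> d fmin; split => // y; rewrite dot0p adde0. Qed.

(** The triples (p, r, g) such that (p, r) is in the epigraph of f and
y |-> r + <g, y - p> minorizes f form a closed set, and such a triple with p = z
makes g a subgradient at z. On a compact part of this set the distance from p to z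
attains its minimum; the proximal points of z make the minimum zero. *)
Lemma subdiff_nonempty f x0 mu (L : R) z :
  0 <= L -> classM mu L%:E x0 f -> exists g, subdiff f z g.
Proof.
move=> L0 [[[fpr [xd fxd]] fcl fcv fsm _] fmin].
have [m0 fx0] : exists m0, f x0 = m0%:E.
  move: (fpr x0) (fmin xd) fxd; rewrite /dom /=.
  case: (f x0) => [m0| |] //; first by exists m0.
  by case: (f xd).
have s0 : subdiff f x0 0.
  by apply: subdiff_minimizer => //; rewrite /dom /= fx0 ltry.
have {}fsm x1 x2 g1 g2 : subdiff f x1 g1 -> subdiff f x2 g2 ->
    enorm (g1 - g2) <= L * enorm (x1 - x2).
  by case: fsm => // h h1 h2; have := h _ _ _ _ h1 h2; rewrite lee_fin.
set D := dotp (x0 - z) (x0 - z); have D0 : 0 <= D by exact: dotp_ge0.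
pose G := 4 * L ^+ 2 * D.
pose B := ([set x : 'rV[R]_n | dotp (x - z) (x - z) <= D]
  `*` `[m0, m0 + G + 4 * D]%classic) `*`
  [set g : 'rV[R]_n | dotp (g - 0) (g - 0) <= G].
pose T := ('rV[R]_n * R * 'rV[R]_n)%type.
pose below (y : 'rV[R]_n) (s : R) :=
  [set q : T | q.1.2 + dotp q.2 (y - q.1.1) <= s].
pose S := [set q : T | epigraph f q.1] `&`
  \bigcap_(w in epigraph f) below w.1 w.2.
pose K := S `&` B.
have cB : compact B.
  apply: compact_setX; last exact: euclidean_ball_compact.
  by apply: compact_setX; [exact: euclidean_ball_compact|exact: segment_compact].
have c11 : continuous (fun q : T => q.1.1).
  move=> q; exact: (@continuous_comp _ _ _ fst fst q cvg_fst cvg_fst).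
have c12 : continuous (fun q : T => q.1.2).
  move=> q; exact: (@continuous_comp _ _ _ fst snd q cvg_fst cvg_snd).
have c2 : continuous (fun q : T => q.2) by move=> q; exact: cvg_snd.
have cS : closed S.
  apply: closedI.
    by apply: (@preimage_closed _ _ fst) => // q _; exact: cvg_fst.
  apply: closed_bigI => w _; apply: continuous_fun_le_closed.
    move=> q; apply: cvgD; first exact: c12.
    apply: dotp_continuous => //; apply: rV_continuousB => //.
    by move=> ?; exact: cvg_cst.
  by move=> ?; exact: cvg_cst.
have cK : compact K.
  apply: (@subclosed_compact _ _ B) => //; last by move=> q [].
  by apply: closedI => //; apply: compact_closed => //; exact: norm_hausdorff.
(* The subgradient g = 2 k (z - p) at a proximal point satisfies |g|^2 <= G, since 0
   is a subgradient at x0 and |p - x0| <= 2 |x0 - z|; hence |p - z| = O(1 / k). *)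
have approx k : 0 < k -> exists2 q, K q &
    4 * k ^+ 2 * dotp (q.1.1 - z) (q.1.1 - z) <= G.
  move=> k0; have [p [r [fp m0r pD pmin]]] := prox_exists f x0 z m0 k fcl fx0 fmin k0.
  have sg := subdiff_prox f z p r k fpr fcv fp pmin.
  move: sg; set g := (2 * k) *: (z - p) => sg.
  have gE : g = (2 * k) *: (z - p) by [].
  clearbody g.
  have pzD : dotp (p - z) (p - z) <= D.
    by rewrite -(ler_pM2l k0); move: pD; rewrite -/D; lra.
  have pxD : dotp (p - x0) (p - x0) <= 4 * D.
    have -> : p - x0 = (p - z) - (x0 - z) by apply/rowP => i; rewrite !mxE; ring.
    have := dotp_ge0 ((p - z) + (x0 - z)).
    move: pzD; rewrite /D; move: (p - z) (x0 - z) => u w.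
    by rewrite !dotpE (dotpC w u); lra.
  have gG : dotp g g <= G.
    have := fsm _ _ _ _ sg s0; rewrite subr0.
    rewrite enorm_le ?mulr_ge0 ?enorm_ge0 // exprMn enorm_sqr => /le_trans; apply.
    by have := ler_wpM2l (sqr_ge0 L) pxD; rewrite /G; lra.
  exists ((p, r), g); last first.
    move: gG; rewrite gE !dotpE /= => gG; apply: le_trans gG.
    by rewrite expr2; lra.
  case: (sg) => _ sgy; split; split.
  - by rewrite /epigraph /= fp.
  - move=> [y s] fys; rewrite /below /= -lee_fin; apply: le_trans fys.
    by have := sgy y; rewrite fp.
  - split => //=; rewrite in_itv /= m0r /=.
    have := sgy x0; rewrite fp fx0 lee_fin.
    have := dotp_ge0 (g + (x0 - p)); move: pxD.
    rewrite -(opprB x0 p).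
    move: gG; move: (x0 - p) => u; rewrite !dotpE (dotpC u g).
    have := dotp_ge0 g; have := dotp_ge0 u; lra.
  - by rewrite /= subr0.
have K0 : K !=set0 by have [q Kq _] := approx 1 ltr01; exists q.
pose phi (q : T) := dotp (q.1.1 - z) (q.1.1 - z).
have cphi : continuous phi.
  have cw : continuous (fun q : T => q.1.1 - z).
    by apply: rV_continuousB => // ?; exact: cvg_cst.
  exact: (dotp_continuous _ _ _ cw cw).
have [[[p r] g] /set_mem [[epr bel] _] qmin] :=
  compact_EVT_min K0 cK (continuous_subspaceT cphi).
have pz : p = z.
  apply/eqP; rewrite -subr_eq0; apply/eqP; apply: dotp_le0.
  apply: (@ler_addscale _ _ _ G) => t /andP[t0 t1].
  have [q Kq qG] : exists2 q, K q & 4 * t^-1 ^+ 2 * dotp (q.1.1 - z) (q.1.1 - z) <= G.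
    by apply: approx; rewrite invr_gt0.
  have := qmin q (mem_set Kq); rewrite /phi /= => /le_trans; apply.
  have := dotp_ge0 (q.1.1 - z); move: qG; rewrite exprVn.
  move: (dotp _ _) => d; rewrite -mulrA mulrCA ler_pdivrMl ?exprn_gt0 // => qG d0.
  have G0 : 0 <= G by rewrite /G mulr_ge0 // mulr_ge0 // sqr_ge0.
  rewrite add0r; move: qG; rewrite expr2 => qG.
  have : t * t * G <= t * G by rewrite ler_wpM2r // ger_pMr // ltW.
  lra.
rewrite pz in epr bel; exists g.
have [a fz] : exists a, f z = a%:E.
  move: (fpr z) epr; rewrite /epigraph /=; case: (f z) => // a _ _; by exists a.
have ar : a <= r by move: epr; rewrite /epigraph /= fz.
split; first by rewrite /dom /= fz ltry.
move=> y; move: (fpr y); case fy : (f y) => [s| |] // _; last by rewrite leey.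
have /= := bel (y, s); rewrite /epigraph /below /= fy => /(_ (lexx _)).
by rewrite fz lee_fin; lra.
Qed.

End Subgradients.

(** * First-order inequalities for smooth strongly convex functions *)

Section FirstOrder.
Context {R : realType} {n : nat}.
Implicit Types (F : 'rV[R]_n -> R) (G : 'rV[R]_n -> 'rV[R]_n) (x y z : 'rV[R]_n).

Lemma classM_gradient (f : 'rV[R]_n -> \bar R) x0 (mu L : R) :
  0 <= L -> classM mu L%:E x0 f ->
  exists F G, [/\ forall x, f x = (F x)%:E,
    forall x y, F x + dotp (G x) (y - x) + mu / 2 * dotp (y - x) (y - x) <= F y,
    forall x y, enorm (G x - G y) <= L * enorm (x - y) &
    G x0 = 0].
Proof.
move=> L0 fM.
have [G Gf] := choice (fun x => subdiff_nonempty f x0 mu L x L0 fM).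
case: fM => [[[fpr _] fcl fcv fsm fsc] fmin].
pose F x := fine (f x).
have fF x : f x = (F x)%:E.
  have [+ _] := Gf x; have := fpr x; rewrite /dom /F /=.
  by case: (f x).
have GL x y : enorm (G x - G y) <= L * enorm (x - y).
  by case: fsm => // /(_ _ _ _ _ (Gf x) (Gf y)); rewrite lee_fin.
exists F, G; split => //; last first.
  have s0 : subdiff f x0 0.
    by apply: subdiff_minimizer => //; rewrite /dom /= fF ltry.
  case: fsm => // /(_ _ _ _ _ (Gf x0) s0); rewrite lee_fin subrr enorm0 mulr0 subr0.
  by rewrite enorm_le // expr0n /= => /dotp_le0.
move=> x y.
apply: (@ler_addscale _ _ _ (mu / 2 * dotp (y - x) (y - x))) => t t01.
have := fsc y x t t01; rewrite !fF -!EFinB -!EFinM -EFinD lee_fin !enorm_sqr.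
have := (Gf x).2 (t *: y + (1 - t) *: x); rewrite !fF lee_fin.
have -> : t *: y + (1 - t) *: x = x + t *: (y - x).
  by apply/rowP => i; rewrite !mxE; ring.
have -> : x + t *: (y - x) - x = t *: (y - x) by rewrite addrC addKr.
have -> : dotp y y = dotp (x + (y - x)) (x + (y - x)) by rewrite addrCA subrr addr0.
move: (y - x) (G x) (F (x + _)) => d g Fw.
rewrite !dotpE (dotpC d x) => h1 h2; case/andP: t01 => t0 _.
by rewrite -(ler_pM2l t0); lra.
Qed.

(** The bound integrates the gradient along the segment. Instead of an integral, the
segment is cut into N equal pieces; convexity bounds the increment over a piece by
the gradient at its end, and the sum exceeds the claimed bound by at most O(1 / N). *)
Lemma descent F G (L : R) :
  0 <= L ->
  (forall x y, F x + dotp (G x) (y - x) <= F y) ->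
  (forall x y, enorm (G x - G y) <= L * enorm (x - y)) ->
  forall x y, F y <= F x + dotp (G x) (y - x) + L / 2 * dotp (y - x) (y - x).
Proof.
move=> L0 Fg GL x y; have -> : y = x + (y - x) by rewrite addrC subrK.
rewrite [x + (y - x) - x]addrC addKr; move: (y - x) => d.
apply: (@ler_addinv _ _ _ (L / 2 * dotp d d)) => k.
have : 0 < k.+2%:R :> R by rewrite ltr0n.
move NE : k.+2%:R => N N0.
pose q (j : nat) := x + (j%:R / N) *: d.
have step j : F (q j.+1) - F (q j) <=
    dotp (G x) d / N + L * dotp d d * j.+1%:R / N ^+ 2.
  have := Fg (q j.+1) (q j).
  have -> : q j - q j.+1 = - N^-1 *: d.
    by apply/rowP => i; rewrite !mxE -natr1; field; rewrite gt_eqF.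
  have : dotp (G (q j.+1) - G x) d <= L * (j.+1%:R / N) * dotp d d.
    apply: le_trans (dotp_CS _ _) _.
    rewrite -enorm_sqr expr2 mulrA ler_wpM2r ?enorm_ge0 //.
    apply: le_trans (GL _ _) _; rewrite /q addrAC subrr add0r enormZ.
    by rewrite ger0_norm ?mulrA // divr_ge0 // ltW.
  rewrite !dotpE -(ler_pM2l (_ : 0 < N^-1)) ?invr_gt0 //.
  have -> : L * dotp d d * j.+1%:R / N ^+ 2 =
            N^-1 * (L * (j.+1%:R / N) * dotp d d).
    by field; rewrite gt_eqF.
  move: (N^-1 * (L * _ * _)) => c; lra.
have tele j : F (q j) - F x <=
    j%:R * (dotp (G x) d / N) + L * dotp d d / N ^+ 2 * (j%:R * (j%:R + 1) / 2).
  elim: j => [|j IH]; first by rewrite /q !mul0r scale0r addr0 subrr mulr0 addr0.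
  have := step j; rewrite -natr1.
  have -> : L * dotp d d * (j%:R + 1) / N ^+ 2 = L * dotp d d / N ^+ 2 * (j%:R + 1).
    by field; rewrite gt_eqF.
  move: (L * dotp d d / _) (dotp (G x) d / N) IH => c b IH h; lra.
have := tele k.+2; rewrite /q NE divff ?gt_eqF // scale1r.
have -> : N * (dotp (G x) d / N) = dotp (G x) d by field; rewrite gt_eqF.
have -> : L * dotp d d / N ^+ 2 * (N * (N + 1) / 2) =
          L / 2 * dotp d d + L / 2 * dotp d d / N by field; rewrite gt_eqF.
lra.
Qed.

(** With g = G x and d = x - x0, the conclusion squared and expanded is the
co-coercivity inequality |g - mu d|^2 <= (L - mu) <g - mu d, d>. It is the sum of two
applications of the gap estimate in the proof, with the roles of x and x0
exchanged. *)
Lemma gradient_in_ball F G x0 (mu L : R) :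
  0 <= mu < L ->
  (forall x y, F x + dotp (G x) (y - x) + mu / 2 * dotp (y - x) (y - x) <= F y) ->
  (forall x y, enorm (G x - G y) <= L * enorm (x - y)) ->
  G x0 = 0 ->
  forall x, enorm (2 *: G x - (L + mu) *: (x - x0)) <= (L - mu) * enorm (x - x0).
Proof.
move=> /andP[mu0 muL] Fsc GL Gx0 x.
have l0 : 0 < L - mu by rewrite subr_gt0.
have Fcv a b : F a + dotp (G a) (b - a) <= F b.
  apply: le_trans (Fsc a b); rewrite lerDl mulr_ge0 ?dotp_ge0 //; lra.
have Fd := descent _ _ _ (ltW (le_lt_trans mu0 muL)) Fcv GL.
(* The upper model at b and the lower model at a are compared at the minimizer c
   of the difference between them. *)
have gap a b v : v = G a - G b - mu *: (a - b) ->
    F a + dotp (G a) (b - a) + mu / 2 * dotp (b - a) (b - a)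
      + dotp v v / (2 * (L - mu)) <= F b.
  move=> vE; set s := (L - mu)^-1; pose c := b + s *: v.
  have -> : dotp v v / (2 * (L - mu)) = s * dotp v v / 2.
    by rewrite /s; field; rewrite gt_eqF.
  have s2 : (L - mu) * (s * (s * dotp v v)) = s * dotp v v.
    by rewrite /s; field; rewrite gt_eqF.
  have := Fsc a c; have := Fd b c.
  have -> : c - b = s *: v by rewrite /c addrC addKr.
  have -> : c - a = (b - a) + s *: v by rewrite /c addrAC.
  have vv : s * dotp v v = s * dotp (G a) v - s * dotp (G b) v
      + s * mu * dotp (b - a) v.
    by rewrite {1}vE -(opprB b a) !dotpE; ring.
  clearbody s; move: vv; move: (b - a) => w; rewrite !dotpE (dotpC v w) => vv.
  lra.
have := gap x x0 (G x - mu *: (x - x0)); rewrite Gx0 subr0 => /(_ erefl) h1.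
have : - (G x - mu *: (x - x0)) = 0 - G x - mu *: (x0 - x).
  by rewrite -(opprB x x0) scalerN opprB opprK sub0r addrC.
rewrite -Gx0 => /gap; rewrite Gx0 => h2.
move: h1 h2; rewrite dot0p -(opprB x x0) !(dotpNl, dotpNr) !opprK => h1 h2.
rewrite enorm_le; last by rewrite mulr_ge0 ?enorm_ge0 // ltW.
rewrite exprMn enorm_sqr; move: (x - x0) (G x) h1 h2 => d g.
have q0 : 2 * (L - mu) * (dotp (g - mu *: d) (g - mu *: d) / (2 * (L - mu))) =
    dotp (g - mu *: d) (g - mu *: d) by field; rewrite gt_eqF.
move: q0; set A := _ / (2 * (L - mu)); clearbody A.
rewrite !dotpE (dotpC d g) => q0 h1 h2.
have : (L - mu) * (mu * dotp d d + 2 * A) <= (L - mu) * dotp g d.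
  by rewrite ler_pM2l //; lra.
rewrite expr2; lra.
Qed.

End FirstOrder.

(** * Stationarity of a minimizer of the sum *)

(** At y = x - t S, where S is the sum of the gradients at x, the gradient
inequalities at y and the minimality of x give <sum of G i y, S> <= 0, and G i y
differs from G i x by O(t). The Lipschitz bound replaces differentiability. *)
Lemma sum_gradient_eq0 (R : realType) (n m : nat) (F : 'I_m -> 'rV[R]_n -> R)
    (G : 'I_m -> 'rV[R]_n -> 'rV[R]_n) (L : 'I_m -> R) (x : 'rV[R]_n) :
  (forall i y z, F i y + dotp (G i y) (z - y) <= F i z) ->
  (forall i y z, enorm (G i y - G i z) <= L i * enorm (y - z)) ->
  (forall y, \sum_i F i x <= \sum_i F i y) ->
  \sum_i G i x = 0.
Proof.
move=> Fg GL xmin; set S := \sum_i G i x.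
apply: dotp_le0; apply: (@ler_addscale _ _ _ ((\sum_i L i) * dotp S S)) => t.
case/andP=> t0 _; rewrite add0r; pose y := x - t *: S.
have h1 : dotp (\sum_i G i y) S <= 0.
  have : \sum_i dotp (G i y) (x - y) <= 0.
    rewrite -(lerD2l (\sum_i F i y)) -big_split addr0 /=.
    by apply: le_trans (xmin y); apply: ler_sum => i _; exact: Fg.
  have -> : x - y = t *: S by rewrite /y opprB addrC subrK.
  by rewrite -dotp_suml dotpZr pmulr_rle0.
have h2 i : dotp (G i x - G i y) S <= t * (L i * dotp S S).
  apply: le_trans (dotp_CS _ _) _.
  rewrite -enorm_sqr expr2 !mulrA ler_wpM2r ?enorm_ge0 // -mulrA mulrCA.
  apply: le_trans (GL _ _ _) _.
  by rewrite /y opprB addrC subrK enormZ gtr0_norm.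
have : \sum_i dotp (G i x - G i y) S <= t * ((\sum_i L i) * dotp S S).
  by rewrite mulr_suml mulr_sumr; apply: ler_sum => i _; exact: h2.
rewrite -dotp_suml sumrB dotpDl dotpNl -/S; lra.
Qed.

(** * Quadratic functions with a prescribed gradient *)

Section RankOneQuadratic.
Context {R : realType} {n : nat}.
Context (mu c : R) (v x0 : 'rV[R]_n).

(** A quadratic whose Hessian mu I + c v v^T has eigenvalues mu and mu + c |v|^2. *)
Definition quad (y : 'rV[R]_n) : R :=
  mu / 2 * dotp (y - x0) (y - x0) + c / 2 * dotp v (y - x0) ^+ 2.

Definition quad_grad (y : 'rV[R]_n) : 'rV[R]_n :=
  mu *: (y - x0) + (c * dotp v (y - x0)) *: v.

(** Exact, as the function has degree two; the remainder is a nonnegative form when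
mu and c are nonnegative. *)
Lemma quad_taylor x y :
  quad y = quad x + dotp (quad_grad x) (y - x)
    + (mu / 2 * dotp (y - x) (y - x) + c / 2 * dotp v (y - x) ^+ 2).
Proof.
have -> : y - x = (y - x0) - (x - x0) by apply/rowP => i; rewrite !mxE; ring.
rewrite /quad /quad_grad; move: (y - x0) (x - x0) => a b.
by rewrite !dotpE (dotpC b a); field.
Qed.

Context (mu0 : 0 <= mu) (c0 : 0 <= c).

Lemma quad_form_ge0 w : 0 <= mu / 2 * dotp w w + c / 2 * dotp v w ^+ 2.
Proof.
by apply: addr_ge0; rewrite mulr_ge0 ?sqr_ge0 ?dotp_ge0 ?divr_ge0.
Qed.

Lemma quad_ge_affine x y : quad x + dotp (quad_grad x) (y - x) <= quad y.
Proof. by rewrite (quad_taylor x y) lerDl quad_form_ge0. Qed.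

(** Stated along a continuous map because the epigraph is a subset of the product. *)
Lemma quad_continuous (T : topologicalType) (u : T -> 'rV[R]_n) :
  continuous u -> continuous (fun t => quad (u t)).
Proof.
move=> cu.
have cy : continuous (fun t => u t - x0).
  by apply: rV_continuousB => //; exact: cst_continuous.
have cd : continuous (fun t => dotp v (u t - x0)).
  by apply: dotp_continuous => //; exact: cst_continuous.
move=> t; rewrite /quad; apply: cvgD.
  apply: cvgM; first exact: cvg_cst.
  exact: (dotp_continuous _ _ _ cy cy).
apply: cvgM; first exact: cvg_cst.
by apply: cvgM; exact: cd.
Qed.

Lemma quad_segment x y t :
  quad (t *: x + (1 - t) *: y) = t * quad x + (1 - t) * quad y
    - t * (1 - t) * (mu / 2 * dotp (x - y) (x - y) + c / 2 * dotp v (x - y) ^+ 2).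
Proof.
rewrite /quad.
have -> : t *: x + (1 - t) *: y - x0 = t *: (x - x0) + (1 - t) *: (y - x0).
  by apply/rowP => i; rewrite !mxE; ring.
have -> : x - y = (x - x0) - (y - x0) by apply/rowP => i; rewrite !mxE; ring.
move: (x - x0) (y - x0) => a b.
by rewrite !dotpE (dotpC b a); field.
Qed.

Context (L : R) (cvL : c * dotp v v <= L - mu).

(** With w the difference between g and the gradient, the subgradient inequality at
x + t w and the exact expansion of quad give |w|^2 = O(t). *)
Lemma subdiff_quad x g : subdiff (fun y => (quad y)%:E) x g -> g = quad_grad x.
Proof.
move=> [_ gx]; apply/eqP; rewrite -subr_eq0; apply/eqP; apply: dotp_le0.
set w := g - quad_grad x.
apply: (@ler_addscale _ _ _ (mu / 2 * dotp w w + c / 2 * dotp v w ^+ 2)) => t.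
case/andP=> t0 _.
have := gx (x + t *: w); rewrite -EFinD lee_fin (quad_taylor x (x + t *: w)).
have -> : x + t *: w - x = t *: w by rewrite addrC addKr.
have -> : g = quad_grad x + w by rewrite addrC subrK.
clearbody w; rewrite !dotpE !expr2 => h; rewrite -(ler_pM2l t0); lra.
Qed.

Lemma classM_quad : classM mu L%:E x0 (fun y => (quad y)%:E).
Proof.
split; last first.
  move=> y; rewrite lee_fin /quad subrr (dotpC v) !dot0p expr0n !mulr0 addr0.
  exact: quad_form_ge0.
split.
- by split; [move=> x; exact: ltNyr | exists x0; rewrite /dom /= ltry].
- rewrite /closed_fun.
  have -> : epigraph (fun y => (quad y)%:E) = [set q | quad q.1 <= q.2].
    by apply/seteqP; split => q; rewrite /epigraph /= lee_fin.
  apply: continuous_fun_le_closed; last by move=> q; exact: cvg_snd.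
  by apply: quad_continuous => q; exact: cvg_fst.
- move=> x y t /andP[t0 t1]; rewrite -!EFinM -EFinD lee_fin quad_segment gerBl.
  by rewrite mulr_ge0 ?quad_form_ge0 // mulr_ge0 ?subr_ge0 // ltW.
- right=> x1 x2 g1 g2 /subdiff_quad -> /subdiff_quad ->; rewrite lee_fin.
  have -> : quad_grad x1 - quad_grad x2 = mu *: (x1 - x2) + (c * dotp v (x1 - x2)) *: v.
    have -> : x1 - x2 = (x1 - x0) - (x2 - x0) by apply/rowP => i; rewrite !mxE; ring.
    rewrite /quad_grad; move: (x1 - x0) (x2 - x0) => a b.
    by rewrite !dotpE; apply/rowP => i; rewrite !mxE; ring.
  move: (x1 - x2) => d; apply: le_trans (ler_enormD _ _) _.
  rewrite !enormZ (ger0_norm mu0) normrM (ger0_norm c0).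
  have : `|dotp v d| <= enorm v * enorm d.
    rewrite ler_norml dotp_CS andbT lerNl -dotpNl (le_trans (dotp_CS _ _)) //.
    by rewrite -scaleN1r enormZ normrN normr1 mul1r.
  move: cvL; rewrite -enorm_sqr; have := enorm_ge0 v; have := enorm_ge0 d.
  move: (enorm v) (enorm d) `|_| => a b e b0 a0 cL eab.
  have h1 : c * e * a <= c * (a * b) * a by rewrite ler_wpM2r // ler_wpM2l.
  have := ler_wpM2r b0 cL; lra.
- move=> x y t /andP[t0 t1]; rewrite -!EFinB -!EFinM -EFinD lee_fin !enorm_sqr.
  rewrite quad_segment.
  have : 0 <= t * (1 - t) * (c / 2 * dotp v (x - y) ^+ 2).
    by apply: mulr_ge0; apply: mulr_ge0;
      rewrite ?sqr_ge0 ?subr_ge0 ?divr_ge0 ?(ltW t0) ?(ltW t1).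
  by rewrite !dotpE (dotpC y x); lra.
Qed.

End RankOneQuadratic.

(** * Gradients attained in a ball and the theorem *)

(** The quadratic with v = g - mu d and c = 1 / <v, d>, where d = x - x0. If
<v, d> = 0 then v = 0, and the convention 0^-1 = 0 gives c = 0, which is the correct
function in this case. *)
Lemma classM_interpolation (R : realType) (n : nat) (mu L : R) (x0 x g : 'rV[R]_n) :
  0 <= mu < L ->
  enorm (2 *: g - (L + mu) *: (x - x0)) <= (L - mu) * enorm (x - x0) ->
  exists F : 'rV[R]_n -> R, classM mu L%:E x0 (fun y => (F y)%:E) /\
    forall y, F x + dotp g (y - x) <= F y.
Proof.
move=> /andP[mu0 muL]; have l0 : 0 < L - mu by rewrite subr_gt0.
rewrite enorm_le; last by rewrite mulr_ge0 ?enorm_ge0 // ltW.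
rewrite exprMn enorm_sqr; set d := x - x0 => gd.
pose v := g - mu *: d; pose c := (dotp v d)^-1.
have vd : dotp v v <= (L - mu) * dotp v d.
  by move: gd; rewrite /v; clearbody d; rewrite !dotpE (dotpC d g) expr2; lra.
have vd0 : 0 <= dotp v d.
  by rewrite -(pmulr_rge0 _ l0) (le_trans (dotp_ge0 v)).
have c0 : 0 <= c by rewrite invr_ge0.
have cv : c * dotp v v <= L - mu.
  rewrite /c; have [->|vdn] := eqVneq (dotp v d) 0; first by rewrite invr0 mul0r ltW.
  by rewrite mulrC ler_pdivrMr // lt_neqAle eq_sym vdn.
exists (quad mu c v x0); split; first exact: classM_quad.
suff -> : g = quad_grad mu c v x0 x by move=> y; exact: quad_ge_affine.
rewrite /quad_grad -/d /c; have [vdn|vdn] := eqVneq (dotp v d) 0.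
  have v0 : v = 0 by apply: dotp_le0; rewrite vdn mulr0 in vd.
  by rewrite v0 scaler0 addr0; apply/eqP; rewrite -subr_eq0 -/v v0.
by rewrite mulVf // scale1r /v addrC subrK.
Qed.

Theorem mainTheorem3 (R : realType) (n m : nat) (mu L : 'I_m -> R)
    (hmuL : forall i : 'I_m, 0 <= mu i < L i)
    (xs : 'I_m -> 'rV[R]_n) (xstar : 'rV[R]_n) :
  (exists f : 'I_m -> 'rV[R]_n -> \bar R,
      (forall i : 'I_m, classM (mu i) (L i)%:E (xs i) (f i)) /\
      minimizer (fun x : 'rV[R]_n => (\sum_(i < m) f i x)%E) xstar)
  <->
  enorm (\sum_(i < m) (L i + mu i) *: (xstar - xs i))
    <= \sum_(i < m) (L i - mu i) * enorm (xstar - xs i).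
Proof.
have L0 i : 0 <= L i by case/andP: (hmuL i) => h /ltW; exact: le_trans.
split=> [[f [fM fmin]]|ineq].
  have [F FP] := choice (fun i =>
    classM_gradient (f i) (xs i) (mu i) (L i) (L0 i) (fM i)).
  have {FP}[G FG] := choice FP.
  have S0 : \sum_i G i xstar = 0.
    apply: (sum_gradient_eq0 R n m F G L).
    - move=> i y z; have [_ Fsc _ _] := FG i; apply: le_trans (Fsc y z).
      by rewrite lerDl mulr_ge0 ?dotp_ge0 // divr_ge0 //; case/andP: (hmuL i).
    - by move=> i; have [] := FG i.
    - move=> y; have := fmin y.
      have E z : (\sum_(i < m) f i z)%E = (\sum_i F i z)%:E.
        by rewrite -sumEFin; apply: eq_bigr => i _; have [] := FG i.
      by rewrite !E lee_fin.
  have -> : \sum_(i < m) (L i + mu i) *: (xstar - xs i) =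
      - \sum_(i < m) (2 *: G i xstar - (L i + mu i) *: (xstar - xs i)).
    by rewrite sumrB -scaler_sumr S0 scaler0 sub0r opprK.
  rewrite -scaleN1r enormZ normrN normr1 mul1r.
  apply: le_trans (ler_enorm_sum _ _) _; apply: ler_sum => i _.
  have [_ Fsc GL G0] := FG i.
  exact: gradient_in_ball (hmuL i) Fsc GL G0 xstar.
move: ineq; set S := \sum_i _; set T := \sum_i _ => ST.
(* In ball i, take the point at the fraction |S| / T of the radius from the centre, in
   the direction opposite to S; all the displacements sum to minus half of S. *)
pose g i := 2^-1 *: ((L i + mu i) *: (xstar - xs i)
  - ((L i - mu i) * enorm (xstar - xs i) / T) *: S).
have T0 : 0 <= T by exact: le_trans (enorm_ge0 _) ST.
(* If T = 0 then S = 0 too, so T / T = 0 does no harm. *)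
have S_T : (T / T) *: S = S.
  have [T00|Tn] := eqVneq T 0; last by rewrite divff // scale1r.
  suff -> : S = 0 by rewrite scaler0.
  by apply: dotp_le0; move: ST; rewrite T00 enorm_le // expr0n.
have g0 : \sum_i g i = 0.
  by rewrite -scaler_sumr sumrB -scaler_suml -mulr_suml -/S -/T S_T subrr scaler0.
have gball i : enorm (2 *: g i - (L i + mu i) *: (xstar - xs i))
    <= (L i - mu i) * enorm (xstar - xs i).
  have l0 : 0 <= L i - mu i by case/andP: (hmuL i) => _ /ltW; rewrite subr_ge0.
  rewrite scalerA divff ?pnatr_eq0 // scale1r addrAC subrr add0r.
  rewrite -scaleNr enormZ normrN ger0_norm; last first.
    by rewrite divr_ge0 ?mulr_ge0 ?enorm_ge0.
  rewrite -[X in X <= _]mulrA ler_piMr ?mulr_ge0 ?enorm_ge0 //.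
  have [->|Tn] := eqVneq T 0; first by rewrite invr0 mul0r ler01.
  by rewrite mulrC ler_pdivrMr ?mul1r // lt_neqAle eq_sym Tn.
have [F FP] := choice (fun i =>
  classM_interpolation R n (mu i) (L i) (xs i) xstar (g i) (hmuL i) (gball i)).
exists (fun i y => (F i y)%:E); split=> [i|y]; first by have [] := FP i.
rewrite !sumEFin lee_fin.
have : \sum_i (F i xstar + dotp (g i) (y - xstar)) <= \sum_i F i y.
  by apply: ler_sum => i _; have [_] := FP i.
by rewrite big_split /= -dotp_suml g0 dot0p addr0.
Qed.
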